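(* Let $X$ be a Tychonoff space such that at least one of the following holds: (1) the points of $X$ are $G_{\delta}$ (i.e. every singleton is a $G_\delta$ subset of $X$); (2) $X$ is locally countably compact; (3) $X$ is a $cb$-space. Then $C_{\Gamma}(X)$ is pseudocomplete.
   Context: $C(X)$ is the set of all continuous functions $f:X\to\mathbb R$. The graph topology $\tau_{\Gamma}$ on $C(X)$ is the topology generated by the sets $F_U=\{f\in C(X): \text{graph}(f)\subseteq U\}$, where $U$ ranges over all nonempty open subsets of $X\times\mathbb R$; $C_{\Gamma}(X)$ denotes $(C(X),\tau_{\Gamma})$. $X$ is locally countably compact if every point of $X$ has an open neighborhood with countably compact closure. $X$ is a $cb$-space if for each strictly positive lower semicontinuous $\varepsilon:X\to\mathbb R$ there is a strictly positive continuous $\varphi:X\to\mathbb R$ with $\varepsilon(x)\ge\varphi(x)$ for all $x\in X$. A space $Z$ is quasi-regular if each nonempty open set contains the closure of a nonempty open set. A $\pi$-base of $Z$ is a family of nonempty open sets such that every nonempty open subset of $Z$ contains a member of the family. A space $Z$ is pseudocomplete if $Z$ is quasi-regular and has a sequence $\{\mathcal B_n\}_n$ of $\pi$-bases such that if $B_n\in\mathcal B_n$ and $\overline{B_{n+1}}\subseteq B_n$ for all $n$, then $\bigcap_n B_n\neq\emptyset$. *)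

(* Defs.v *)
From HB Require Import structures.
From mathcomp Require Import all_boot all_order all_algebra.
From mathcomp Require Import all_classical all_reals all_analysis.
Set Implicit Arguments.
Unset Strict Implicit.
Unset Printing Implicit Defensive.

Import Order.TTheory GRing.Theory Num.Theory.
Import numFieldNormedType.Exports.

Local Open Scope classical_set_scope.
Local Open Scope ring_scope.

Definition tychonoff_space (X : topologicalType) : Prop :=
  accessible_space X /\ completely_regular_space X.

Definition countably_compact (X : topologicalType) (A : set X) : Prop :=
  forall U : nat -> set X, (forall n, open (U n)) ->
    A `<=` \bigcup_n U n -> finite_subset_cover [set: nat] U A.

Definition locally_countably_compact (X : topologicalType) : Prop :=
  forall x : X, exists U : set X,
    [/\ open U, U x & countably_compact (closure U)].

Definition cb_space (R : realType) (X : topologicalType) : Prop :=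
  forall eps : X -> R,
    (forall x, 0 < eps x) -> lower_semicontinuous (EFin \o eps) ->
    exists phi : X -> R,
      [/\ continuous phi, forall x, 0 < phi x & forall x, phi x <= eps x].

Definition quasi_regular (Z : topologicalType) : Prop :=
  forall U : set Z, open U -> U !=set0 ->
    exists V : set Z, [/\ open V, V !=set0 & closure V `<=` U].

Definition pi_base (Z : topologicalType) (B : set (set Z)) : Prop :=
  (forall V, B V -> open V /\ V !=set0) /\
  (forall U, open U -> U !=set0 -> exists2 V, B V & V `<=` U).

Definition pseudocomplete (Z : topologicalType) : Prop :=
  quasi_regular Z /\
  exists B : nat -> set (set Z),
    (forall n, pi_base (B n)) /\
    forall V : nat -> set Z,
      (forall n, B n (V n)) -> (forall n, closure (V n.+1) `<=` V n) ->
      \bigcap_n V n !=set0.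

Definition graph_of (X Y : Type) (f : X -> Y) : set (X * Y) :=
  [set p | p.2 = f p.1].

(* An alias is needed: continuousType X R already carries another canonical
   topology (inherited from the function space X -> R). *)
Definition graph_topology (R : realType) (X : topologicalType) : Type :=
  continuousType X R.

Section graph_topology.
Variables (R : realType) (X : topologicalType).
Local Notation C := (graph_topology R X).

Definition graph_within (U : set (X * R)) : set C :=
  [set f | graph_of (f : continuousType X R) `<=` U].

HB.instance Definition _ := Choice.on C.
HB.instance Definition _ := isSubBaseTopological.Build C
  [set U : set (X * R) | open U /\ U !=set0] graph_within.

End graph_topology.

(* Main.v *)
(** The tubes [{g : |g - f| < d}], with [d] positive and lower semicontinuous,
form a base of the graph topology, and bounding [d] by [2^-n] gives the n-th
pi-base. If [V n] is the tube of radius [d n] around [u n] and the closure of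
[V n.+1] lies in [V n], then the centres converge uniformly to a continuous
[f] with [|f - u n| <= d n]. The inequality has to be made strict at each
point [x0]. For this it suffices to find [g] in the closure of [V n.+1] with
[g x0 = f x0]. One takes [g = u n.+1 + a * (f - u n.+1)] with [a : X -> [0,
1]], [a x0 = 1], such that [a] can be approximated within any lower
semicontinuous error by functions [b < 1]. For cb-spaces [a = 1] works; in the
locally countably compact case [a] is a bump function supported where lower
semicontinuous errors are bounded away from zero; if [{x0}] is a G_delta, [a]
attains the value 1 only at [x0]. *)

Require Import Defs.
From mathcomp Require Import all_boot all_order all_algebra finmap.
From mathcomp Require Import all_classical all_reals all_analysis.
From mathcomp Require Import borel_hierarchy ring lra.

Set Implicit Arguments.
Unset Strict Implicit.
Unset Printing Implicit Defensive.

Import Order.TTheory GRing.Theory Num.Theory.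
Import numFieldNormedType.Exports.

Local Open Scope classical_set_scope.
Local Open Scope ring_scope.

(** * Uniform limits and bump functions *)

Lemma dyadic_uniform_limit (R : realType) (X : topologicalType)
    (u : nat -> X -> R) :
  (forall n, continuous (u n)) ->
  (forall n x, `|u n.+1 x - u n x| <= 2^-1 ^+ n) ->
  exists f : X -> R, continuous f /\ forall x, u n x @[n --> \oo] --> f x.
Proof.
move=> cu du.
(* The subtracted [2 * 2^-1 ^+ (n + k)] is the rest of the geometric series: keeping it closes the
   induction, dropping it gives a tail bound uniform in [x]. *)
have tele x n k :
    `|u (n + k)%N x - u n x| <= 2 * 2^-1 ^+ n - 2 * 2^-1 ^+ (n + k).
  elim: k => [|k IH]; first by rewrite addn0 !subrr normr0.
  have := du (n + k)%N x; rewrite addnS exprS.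
  move: (2^-1 ^+ (n + k)) (2^-1 ^+ n) IH => a b; rewrite !ler_norml.
  by move=> /andP[? ?] /andP[? ?]; apply/andP; split; lra.
have tail x n m : (n <= m)%N -> `|u m x - u n x| <= 2 * 2^-1 ^+ n.
  move=> /subnKC <-; apply: le_trans (tele _ _ _) _.
  by rewrite gerBl mulr_ge0 ?exprn_ge0.
have small e : 0 < e -> \forall n \near \oo, 2 * 2^-1 ^+ n < e :> R.
  move=> e0; have /cvgrPdist_lt /(_ e e0) :
      2 * 2^-1 ^+ n @[n --> \oo] --> (0 : R).
    rewrite -[X in _ --> X](mulr0 2); apply: cvgMl_tmp.
    by apply: cvg_expr; rewrite ger0_norm ?invf_lt1 ?ltr1n.
  by apply: filterS => n; rewrite sub0r normrN ger0_norm// mulr_ge0 ?exprn_ge0.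
have cvu x : cvgn (u ^~ x).
  apply/cauchy_cvgP/cauchy_exP => e e0; have [n _ hn] := small e e0.
  exists (u n x); exists n => // m /= nm; rewrite /ball/= distrC.
  exact: le_lt_trans (tail x _ _ nm) (hn n (leqnn n)).
pose f x := limn (u ^~ x).
have fu x n : `|f x - u n x| <= 2 * 2^-1 ^+ n.
  have : `|u m x - u n x| @[m --> \oo] --> `|f x - u n x|.
    by apply: cvg_norm; apply: cvgB; [exact: cvu|exact: cvg_cst].
  move=> h; rewrite -(cvg_lim _ h)//; apply: limr_le; first by apply: cvgP h.
  by exists n => // m /= nm; exact: tail.
exists f; split=> [x|x]; last exact: cvu.
apply/cvgrPdist_lt => e e0.
have e3 : 0 < e / 3 by rewrite divr_gt0.
have [n _ /(_ n (leqnn n)) hn] := small _ e3.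
have /cvgrPdist_lt /(_ _ e3) := cu n x.
apply: filterS => y.
have := fu x n; have := fu y n.
rewrite !ler_norml !ltr_norml.
by move=> /andP[? ?] /andP[? ?] /andP[? ?]; apply/andP; split; lra.
Qed.

Lemma bump (R : realType) (X : topologicalType) (x0 : X) (W : set X) :
  completely_regular_space X -> open W -> W x0 ->
  exists u : X -> R, [/\ continuous u, u x0 = 1, forall x, 0 <= u x <= 1 &
    forall x, ~ W x -> u x = 0].
Proof.
move=> cr oW Wx0.
have /(uniform_separatorP (R := R)) [f [cf f01 fA fB]] :
    uniform_separator [set x0] (~` W).
  by apply: cr; [exact: open_closedC|exact].
exists (fun x => 1 - f x); split.
- by move=> x; apply: cvgB; [exact: cvg_cst|exact: cf].
- by rewrite (fA (f x0)) ?subr0//; exists x0.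
- move=> x; have /f01 /= : range f (f x) by exists x.
  by rewrite in_itv/= => /andP[? ?]; apply/andP; split; lra.
- by move=> x nWx; rewrite (fB (f x)) ?subrr//; exists x.
Qed.

(** * Peak functions under each of the three hypotheses *)

Definition peak (R : realType) (X : topologicalType) (x0 : X) : Prop :=
  exists a : X -> R,
    [/\ continuous a, a x0 = 1, forall x, 0 <= a x <= 1 &
     forall d : X -> R, (forall x, 0 < d x) ->
       lower_semicontinuous (EFin \o d) ->
       exists b : X -> R, [/\ continuous b, forall x, 0 <= b x < 1 &
         forall x, `|a x - b x| < d x]].

Section peak.
Context {R : realType} {X : topologicalType}.

Lemma cb_space_peak (x0 : X) : cb_space R X -> peak R x0.
Proof.
move=> cb; exists (cst 1); split => //=.
- by move=> x; exact: cvg_cst.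
- by move=> x; rewrite ler01 lexx.
move=> d d0 lsd; have [phi [cphi phi0 phid]] := cb d d0 lsd.
(* Halving turns [phi x <= d x] into a strict bound, and the cap at 1 keeps the function
   nonnegative. *)
exists (fun x => 1 - Num.min (phi x) 1 / 2); split.
- move=> x; apply: cvgB; first exact: cvg_cst.
  apply: cvgMr_tmp; apply: (@continuous_min _ _ phi (cst 1)); first exact: cphi.
  exact: cvg_cst.
- move=> x; have := phi0 x; case: (lerP (phi x) 1) => ? ?.
    by apply/andP; split; lra.
  by apply/andP; split; lra.
- move=> x /=; have := phi0 x; have := phid x.
  rewrite opprB addrCA subrr addr0 => ? ?.
  case: (lerP (phi x) 1) => ?; rewrite ger0_norm; lra.
Qed.

(** The open sets where [d] exceeds [1/(n+1)] increase to the whole space, so a finite subcover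
    reduces to its largest index. *)
Lemma countably_compact_lsc_bound (K : set X) (d : X -> R) :
  countably_compact K -> (forall x, 0 < d x) ->
  lower_semicontinuous (EFin \o d) ->
  exists2 c, 0 < c & forall x, K x -> c < d x.
Proof.
move=> ccK d0 /lower_semicontinuousP ld.
have [||D _ KD] := ccK (fun n => [set x | ((n.+1%:R^-1)%:E < (EFin \o d) x)%E]).
- by move=> n; exact: ld.
- move=> x _; have [n hn] := ltr_add_invr (d0 x).
  by exists n => //=; rewrite lte_fin -[X in X < _]add0r.
exists (\max_(n <- enum_fset D) n).+1%:R^-1; first by rewrite invr_gt0.
move=> x /KD [n /= nD]; rewrite lte_fin; apply: le_lt_trans.
by rewrite lef_pV2 ?posrE// ler_nat ltnS; apply: leq_bigmax_seq.
Qed.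

(** Scaling a bump that vanishes off [W] by [1 - s] pushes it below 1 everywhere. The change is at
    most [s], which is less than [d] on [W], and it is zero off [W]. *)
Lemma locally_countably_compact_peak (x0 : X) : completely_regular_space X ->
  locally_countably_compact X -> peak R x0.
Proof.
move=> cr lcc; have [W [oW Wx0 ccW]] := lcc x0.
have [u [cu u1 u01 uW]] := bump R cr oW Wx0.
exists u; split => // d d0 lsd.
have [c c0 cd] := countably_compact_lsc_bound ccW d0 lsd.
pose s := Num.min c 1 / 2.
have s0 : 0 < s by rewrite divr_gt0// lt_min c0 ltr01.
have s1 : s < 1 by rewrite /s; case: (lerP c 1) => ?; lra.
have sc : s < c by rewrite /s; case: (lerP c 1) => ?; lra.
exists (fun x => (1 - s) * u x); split.
- by move=> x; apply: cvgMl_tmp; exact: cu.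
- by move=> x; have /andP[? ?] := u01 x; apply/andP; split; nra.
- move=> x; have [Wx|nWx] := pselect (W x).
    apply: lt_trans (cd x (subset_closure Wx)); have /andP[? ?] := u01 x.
    by rewrite ger0_norm; nra.
  by rewrite uW// mulr0 subrr normr0.
Qed.

(** The witness is the sum of [2^-(n+1) * (1 - u n)], with [u n] a bump at [x0] vanishing off the
    open set [F n]. A point other than [x0] misses some [F n], and that term makes the sum
    positive. *)
Lemma Gdelta_point_zero_set (x0 : X) : completely_regular_space X ->
  Gdelta [set x0] ->
  exists w : X -> R, [/\ continuous w, forall x, 0 <= w x <= 1, w x0 = 0 &
    forall x, x != x0 -> 0 < w x].
Proof.
move=> cr [F oF eF].
have Fx0 n : F n x0 by have : [set x0] x0 by []; rewrite eF; exact.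
have /choice[u hu] n := bump R cr (oF n) (Fx0 n).
pose h n x : R := 2^-1 ^+ n.+1 * (1 - u n x).
pose v n x := \sum_(k < n) h k x.
have h0 n x : 0 <= h n x.
  have [_ _ /(_ x)/andP[? ?] _] := hu n.
  by rewrite mulr_ge0 ?exprn_ge0 ?subr_ge0.
have h1 n x : h n x <= 2^-1 ^+ n.+1.
  have [_ _ /(_ x)/andP[? ?] _] := hu n.
  by rewrite ler_piMr ?exprn_ge0// gerBl.
have [n|n x|w [cw vw]] := @dyadic_uniform_limit R X v.
- elim: n => [|n IH].
    have -> : v 0%N = cst 0 by apply/funext => x; rewrite /v big_ord0.
    by move=> x; exact: cvg_cst.
  have -> : v n.+1 = v n \+ h n.
    by apply/funext => x; rewrite /v big_ord_recr.
  move=> x; apply: cvgD; first exact: IH.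
  apply: cvgMl_tmp; apply: cvgB; first exact: cvg_cst.
  by have [+ _ _ _] := hu n; apply.
- rewrite /v big_ord_recr/= addrAC subrr add0r ger0_norm//.
  apply: le_trans (h1 n x) _.
  by rewrite exprS ler_piMl ?exprn_ge0// invf_le1 ?ler1n.
have v1 n x : v n x <= 1 - 2^-1 ^+ n.
  elim: n => [|n IH]; first by rewrite /v big_ord0 expr0 subrr.
  rewrite /v big_ord_recr/=; move: IH (h1 n x); rewrite -/(v n x) exprS.
  by move: (2^-1 ^+ n) => ? ? ?; lra.
have vmono x : nondecreasing_seq (v ^~ x).
  by apply/nondecreasing_seqP => n; rewrite /v big_ord_recr/= lerDl.
have vlew n x : v n x <= w x.
  rewrite -(cvg_lim _ (vw x))//; apply: nondecreasing_cvgn_le => //.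
  by apply/cvg_ex; exists (w x); exact: vw.
exists w; split => //.
- move=> x; apply/andP; split.
    by apply: le_trans (vlew 0%N x); rewrite /v big_ord0.
  rewrite -(cvg_lim _ (vw x))//; apply: limr_le.
    by apply/cvg_ex; exists (w x); exact: vw.
  by apply: nearW => n; apply: le_trans (v1 n x) _; rewrite gerBl exprn_ge0.
- apply: (cvg_unique _ (vw x0)) => //.
  rewrite [X in X @ _](_ : _ = cst 0); first exact: cvg_cst.
  apply/funext => n; rewrite /v big1// => k _.
  by have [_ e _ _] := hu k; rewrite /h e subrr mulr0.
- move=> x /eqP nx; have : ~ (\bigcap_i F i) x by rewrite -eF.
  move=> /existsNP[n /not_implyP[_ nFx]].
  apply: lt_le_trans (vlew n.+1 x); rewrite /v big_ord_recr/=.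
  apply: ltr_wpDl; first by apply: sumr_ge0 => k _.
  by have [_ _ _ e] := hu n;
    rewrite /h (e x nFx) subr0 mulr1 exprn_gt0 ?invr_gt0.
Qed.

(** Off [x0] the function [1 - w] is already below 1, so only the value at [x0] must be lowered. The
    factor [1 - s * u], with [u] vanishing where [d <= s], does this at a cost of at most [s]. *)
Lemma Gdelta_point_peak (x0 : X) : completely_regular_space X ->
  Gdelta [set x0] -> peak R x0.
Proof.
move=> cr /(Gdelta_point_zero_set cr)[w [cw w01 wx0 w0]].
have ca : continuous (fun x => 1 - w x).
  by move=> x; apply: cvgB; [exact: cvg_cst|exact: cw].
exists (fun x => 1 - w x); split => //.
- by rewrite wx0 subr0.
- by move=> x; have /andP[? ?] := w01 x; apply/andP; split; lra.
move=> d d0 lsd.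
pose s := Num.min (d x0) 1 / 2.
have s0 : 0 < s by rewrite divr_gt0// lt_min d0 ltr01.
have s1 : s < 1 by rewrite /s; case: (lerP (d x0) 1) => ?; lra.
have sd : s < d x0.
  by rewrite /s; case: (lerP (d x0) 1) => ?; have := d0 x0; lra.
have oW : open [set x | (s%:E < (EFin \o d) x)%E].
  by move/lower_semicontinuousP : lsd; exact.
have [|u [cu u1 u01 uW]] := bump R cr oW (x0 := x0).
  by rewrite /= lte_fin.
exists (fun x => (1 - w x) * (1 - s * u x)); split.
- move=> x; apply: cvgM; first exact: ca.
  by apply: cvgB; [exact: cvg_cst|apply: cvgMl_tmp; exact: cu].
- move=> x; have /andP[? ?] := u01 x; have /andP[? ?] := w01 x.
  have [->|/w0 ?] := eqVneq x x0.
    by rewrite wx0 u1; apply/andP; split; lra.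
  have /andP[? ?] : 0 <= s * u x <= 1 by apply/andP; split; nra.
  by rewrite mulr_ge0 ?subr_ge0//=; apply: (@le_lt_trans _ _ (1 - w x));
    [rewrite ler_piMr//; lra|lra].
- move=> x; have /andP[? ?] := u01 x; have /andP[? ?] := w01 x.
  rewrite -{1}[1 - w x]mulr1 -mulrBr opprB addrCA subrr addr0.
  have [|nWx] := pselect ([set x | (s%:E < (EFin \o d) x)%E] x).
    rewrite /= lte_fin; apply: le_lt_trans.
    have /andP[? ?] : 0 <= s * u x <= s by apply/andP; split; nra.
    by rewrite ger0_norm; nra.
  by rewrite uW// !mulr0 normr0.
Qed.

End peak.

(** * Tubes as a base of the graph topology *)

Section tubes.
Context {R : realType} {X : topologicalType}.
Local Notation C := (graph_topology R X).

Definition cfun (g : X -> R) (cg : continuous g) : C :=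
  Continuous.Pack (Continuous.Class (isContinuous.Build X R g cg)).

Lemma cfun_continuous (g : C) : continuous (g : X -> R).
Proof. exact: cts_fun. Qed.

Lemma open_graph_within (U : set (X * R)) :
  open U -> open (graph_within (R := R) U : set C).
Proof.
move=> oU.
have [[p Up]|U0] := pselect (U !=set0).
  exists [set graph_within (R := R) U]; last by rewrite bigcup_set1.
  move=> _ ->; exists (fset1 U).
    by move=> V /fset1P ->; rewrite inE; split => //; exists p.
  by rewrite set_fset1 bigcap_set1.
(* Only nonempty [U] index the subbase. For empty [U] the set is empty, unless [X] itself is empty,
   and then it is the whole space. *)
have [[g Ug]|V0] := pselect (graph_within (R := R) U !=set0).
  rewrite (_ : graph_within (R := R) U = setT); first exact: openT.
  apply/seteqP; split => // h _ [x y] _; exfalso; apply: U0.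
  by exists (x, g x); apply: Ug.
rewrite (_ : graph_within (R := R) U = set0); first exact: open0.
by apply/seteqP; split => // g Ug; case: V0; exists g.
Qed.

(** A graph lies in each of finitely many sets exactly when it lies in their intersection, so the
    subbase is already a base. *)
Lemma graph_within_base (O : set C) (f : C) : open O -> O f ->
  exists U : set (X * R), [/\ open U, graph_within U f & graph_within U `<=` O].
Proof.
move=> [D sD <-] [A DA Af].
have [F hF eA] := sD A DA.
have subF V : V \in F -> open V by move=> /hF; rewrite inE => -[].
exists (\bigcap_(i in [set` F]) i); split.
- rewrite openE => p hp; apply: (@filter_bigI _ _ F id) => V VF.
  by apply: open_nbhs_nbhs; split; [exact: subF|exact: hp].

- by move=> p gp V VF; move: Af; rewrite -eA => /(_ V VF); exact.
- move=> g hg; exists A => //; change (A g); rewrite -eA => V VF p gp.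
  exact: (hg p gp V VF).
Qed.

Definition tube (f : C) (d : X -> R) : set C :=
  [set g : C | forall x, `|g x - f x| < d x].

Lemma open_tube (f : C) (d : X -> R) :
  lower_semicontinuous (EFin \o d) -> open (tube f d).
Proof.
move=> ld.
rewrite (_ : tube f d =
    graph_within [set p | `|p.2 - f p.1| < d p.1]); last first.
  apply/seteqP; split => g hg.
    by move=> [x y]; rewrite /graph_of/= => ->; exact: hg.
  by move=> x; apply: (hg (x, g x)).
apply: open_graph_within; rewrite openE => -[x y] /= h.
(* Near the point, [|y - f x|] stays below the midpoint [m] by continuity and [d] stays above it by
   semicontinuity. *)
pose m := (`|y - f x| + d x) / 2.
have /ld[V Vx Vd] : (m%:E < (EFin \o d) x)%E.
  by move: h; rewrite /= lte_fin /m; lra.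
have mlt : `|y - f x| < m by move: h; rewrite /= /m; lra.
have cn : (`|p.2 - f p.1| @[p --> (x, y)]) --> `|y - f x|.
  apply: cvg_norm; apply: cvgB; first exact: cvg_snd.
  by apply: continuous_cvg; [exact: cfun_continuous|exact: cvg_fst].
have n1 : \forall p \near (x, y), `|p.2 - f p.1| < m by apply: (cvgr_lt _ cn).
have n2 : \forall p \near (x, y), V p.1 by apply: cvg_fst.
near=> p; apply: (@lt_trans _ _ m); first by near: p.
have : V p.1 by near: p.
by move/Vd; rewrite lte_fin.
Unshelve. all: by end_near. Qed.

Lemma tube_center (f : C) (d : X -> R) : (forall x, 0 < d x) -> tube f d f.
Proof. by move=> d0 x; rewrite subrr normr0. Qed.

Lemma tube_in_open (O : set C) (f : C) (c : R) : open O -> O f -> 0 < c ->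
  exists d : X -> R, [/\ lower_semicontinuous (EFin \o d),
    forall x, 0 < d x <= c & tube f d `<=` O].
Proof.
move=> oO Of c0; have [U [oU Uf UO]] := graph_within_base oO Of.
(* These are the radii that fit in [U] over a whole neighbourhood of [x]. Such a radius stays valid
   at nearby points, which makes [sup (T x)] lower semicontinuous; the cap [c] keeps it finite. *)
pose T (x : X) := [set t : R | 0 < t <= c /\ \forall z \near x, forall y,
  `|y - f z| < t -> U (z, y)].
have Tne x : T x !=set0.
  have : nbhs (x, f x) U.
    by apply: open_nbhs_nbhs; split => //; exact: (Uf (x, f x)).
  move=> [[A B] /= [nA nB] AB].
  have /nbhs_ballP[e /= e0 eB] := nB.
  (* One half of [e] absorbs the oscillation of [f] near [x], the other the distance from [y] to
     [f z]. *)
  exists (Num.min c (e / 2)); split.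
    by rewrite lt_min c0 divr_gt0//= ge_min lexx.
  have fe : \forall z \near x, `|f x - f z| < e / 2.
    have /cvgrPdist_lt := @cfun_continuous f x; apply; exact: divr_gt0.
  near=> z => y; rewrite lt_min => /andP[_ yz].
  apply: AB; split => /=; first by near: z.
  apply: eB; rewrite /ball/= (splitr e) -(subrKA (f z)).
  apply: le_lt_trans (ler_normD _ _) _; apply: ltrD; first by near: z.
  by rewrite distrC.
have Tub x : has_ubound (T x) by exists c => t [/andP[]].
have Tsup x : has_sup (T x) by [].
exists (fun x => sup (T x)); split.
- move=> x a; rewrite /= lte_fin => /(sup_gt (Tne x))[t [t0 nt] at_].
  exists [set z | \forall z' \near z, forall y, `|y - f z'| < t -> U (z', y)].
    exact: nbhs_interior nt.
  by move=> z nz; rewrite lte_fin (lt_le_trans at_)// ub_le_sup.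
- move=> x; have [t tT] := Tne x; have [/andP[t0 _] _] := tT.
  rewrite (lt_le_trans t0) ?ub_le_sup//=; apply: ge_sup => //.
  by move=> s [/andP[]].
- move=> g hg; apply: UO => -[x y]; rewrite /graph_of/= => ->.
  have [t [_ nt] gt] := sup_gt (Tne x) (hg x).
  exact: (nbhs_singleton nt).
Unshelve. all: by end_near. Qed.

(** If the bound failed at [x], the set [U] below, which constrains graphs over [x] only, would
    contain the graph of [g] but no graph from the tube. It is open because points are closed. *)
Lemma closure_tube (f g : C) (d : X -> R) : accessible_space X ->
  closure (tube f d) g -> forall x, `|g x - f x| <= d x.
Proof.
move=> T1 cg x; rewrite leNgt; apply/negP => dx.
pose U := [set p : X * R | p.1 != x \/ d x < `|p.2 - f x|].
have oU : open U.
  apply: openU.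
    apply: (@open_comp _ _ fst [set z | z != x]) => [? _|].
      exact: cvg_fst.
    rewrite (_ : [set z | z != x] = ~` [set x]).
      by apply: closed_openC; exact: accessible_closed_set1.
    by apply/seteqP; split => z /eqP.
  apply: (@open_comp _ _ (fun p : X * R => `|p.2 - f x|) [set r | d x < r]).
    by move=> p _; apply: cvg_norm; apply: cvgB;
      [exact: cvg_snd|exact: cvg_cst].
  exact: open_gt.
have Ug : graph_within U g.
  move=> [z y]; rewrite /graph_of /U /= => ->.
  by have [->|] := eqVneq z x; [right|left].
have [|h [hf hU]] := cg (graph_within U).
  by apply: open_nbhs_nbhs; split; [exact: open_graph_within|].
have [/=|/=] := hU (x, h x) erefl; first by rewrite eqxx.
by rewrite ltNge ltW// hf.
Qed.

(** * Quasi-regularity, pi-bases and nested tubes *)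

Lemma quasi_regular_graph_topology :
  accessible_space X -> quasi_regular (graph_topology R X).
Proof.
move=> T1 O oO [f Of]; have [d [ld d01 dO]] := tube_in_open oO Of ltr01.
have d0 x : 0 < d x by have /andP[] := d01 x.
(* Closing a tube at most weakens [<] to [<=], so half the radius leaves room inside [O]. *)
exists (tube f (fun x => d x / 2)); split.
- apply: open_tube => x a; rewrite /= lte_fin ltr_pdivlMr// => ad.
  have /ld[V Vx Vd] : ((a * 2)%:E < (EFin \o d) x)%E by rewrite lte_fin.
  by exists V => // y /Vd; rewrite /= !lte_fin ltr_pdivlMr.
- by exists f; apply: tube_center => x; rewrite divr_gt0.
- move=> g /(closure_tube T1) gf; apply: dO => x; apply: le_lt_trans (gf x) _.
  by have := d0 x; lra.
Qed.

Lemma pi_base_tube (c : R) : 0 < c ->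
  pi_base [set V : set C | exists f d, [/\ lower_semicontinuous (EFin \o d),
    forall x, 0 < d x <= c & V = tube f d]].
Proof.
move=> c0; split=> [_ [f [d [ld d0 ->]]]|O oO [f Of]].
  split; first exact: open_tube.
  by exists f; apply: tube_center => x; have /andP[] := d0 x.
have [d [ld dc dO]] := tube_in_open oO Of c0.
by exists (tube f d) => //; exists f, d.
Qed.

(** As [b < 1], the function [p + b * (f - p)] is strictly within [e] of [p]. As
    [|f - p| <= e <= 1], replacing [a] by [b] moves the combination by at most [|a - b|], which can
    be made smaller than any tube radius around it. *)
Lemma peak_closure_tube (x0 : X) (f p : C) (e : X -> R) : peak R x0 ->
  (forall x, 0 < e x <= 1) -> (forall x, `|f x - p x| <= e x) ->
  exists2 g : C, closure (tube p e) g & g x0 = f x0.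
Proof.
move=> [a [ca a1 a01 ha]] e01 fp.
have ccomb (b : X -> R) : continuous b ->
    continuous (fun x => p x + b x * (f x - p x)).
  move=> cb x; apply: cvgD; first exact: cfun_continuous.
  apply: cvgM; first exact: cb.
  by apply: cvgB; exact: cfun_continuous.
exists (cfun (ccomb a ca)); last by rewrite /= a1 mul1r addrC subrK.
move=> B; rewrite nbhsE => -[G [oG Gg] GB].
have [d [ld d01 dG]] := tube_in_open oG Gg ltr01.
have [|//|b [cb b01 ab]] := ha d; first by move=> x; have /andP[] := d01 x.
exists (cfun (ccomb b cb)); split.
  move=> x /=; rewrite addrAC subrr add0r normrM.
  have /andP[b0 b1] := b01 x; have /andP[e0 _] := e01 x.
  rewrite (ger0_norm b0); apply: (@le_lt_trans _ _ (b x * e x)).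
    exact: ler_wpM2l.
  by rewrite gtr_pMl.
apply: GB; apply: dG => x /=.
rewrite opprD addrACA subrr add0r -mulrBl normrM distrC.
apply: le_lt_trans (ab x); rewrite ler_piMr//.
by apply: le_trans (fp x) _; have /andP[] := e01 x.
Qed.

Lemma pseudocomplete_graph_topology : accessible_space X ->
  (forall x : X, peak R x) -> pseudocomplete (graph_topology R X).
Proof.
move=> T1 pk; split; first exact: quasi_regular_graph_topology.
exists (fun n => [set V : set C | exists f d,
  [/\ lower_semicontinuous (EFin \o d),
      forall x, 0 < d x <= 2^-1 ^+ n & V = tube f d]]).
split=> [n|V hV clV]; first by apply: pi_base_tube; rewrite exprn_gt0.
have /choice[u /choice[d ud]] := hV.
have Vd n : V n = tube (u n) (d n) by have [] := ud n.
have d0 n x : 0 < d n x by have [_ /(_ x)/andP[]] := ud n.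
have dn n x : d n x <= 2^-1 ^+ n by have [_ /(_ x)/andP[]] := ud n.
have Vsub n k : V (n + k)%N `<=` V n.
  elim: k => [|k IH]; first by rewrite addn0.
  by rewrite addnS => g /subset_closure /clV /IH.
(* All later centres lie in [V n]: consecutive ones differ by less than [2^-n], and in the limit a
   weak inequality with [d n] survives. *)
have Vu n k : V n (u (n + k)%N).
  by apply: (Vsub n k); rewrite Vd; exact: tube_center.
have [n x|n x|f [cf uf]] := @dyadic_uniform_limit R X (fun n => u n).
- exact: cfun_continuous.
- have := Vu n 1%N; rewrite addn1 Vd => /(_ x)/ltW/le_trans; apply; exact: dn.
have fu n x : `|f x - u n x| <= d n x.
  have h : `|u m x - u n x| @[m --> \oo] --> `|f x - u n x|.
    by apply: cvg_norm; apply: cvgB; [exact: uf|exact: cvg_cst].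
  rewrite -(cvg_lim _ h)//; apply: limr_le; first by apply: cvgP h.
  exists n => // m /= /subnKC <-.
  by have := Vu n (m - n)%N; rewrite Vd => /(_ x)/ltW.
exists (cfun cf) => n _; rewrite Vd => x0 /=.
(* Here [g] may depend on [x0]: membership in a tube is tested one point at a time, and [f] may be
   replaced by [g] at [x0]. *)
have [x||g cg /= <-] :=
    @peak_closure_tube x0 (cfun cf) (u n.+1) (d n.+1) (pk x0).
- by rewrite d0 (le_trans (dn _ _))// exprn_ile1// invf_le1 ?ler1n.
- exact: fu.
by have := clV n g; rewrite !Vd => /(_ cg); exact.
Qed.

End tubes.

Theorem theorem4p2 (R : realType) (X : topologicalType)
  (hX : tychonoff_space X)
  (h : (forall x : X, Gdelta [set x]) \/
       locally_countably_compact X \/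
       cb_space R X) :
  pseudocomplete (graph_topology R X).
Proof.
have [T1 cr] := hX; apply: pseudocomplete_graph_topology => // x.
case: h => [Gd|[lcc|cb]].
- exact: Gdelta_point_peak.
- exact: locally_countably_compact_peak.
- exact: cb_space_peak.
Qed.
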